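(* Let $\ell\ge 1$ be an integer, let $A=[a_0,\ldots,a_{\ell-1}]$ and $B=[b_0,\ldots,b_{\ell-1}]$ form a quaternary Legendre pair $(A,B)$ of length $\ell$, and put $\alpha=\sum_{j=0}^{\ell-1}a_j$, $\beta=\sum_{j=0}^{\ell-1}b_j$. (i) If $\ell$ is odd and $\alpha=\beta=1$, then $$\left(\begin{array}{cc|cccccc} -1 & -1 & 1 & \ldots & 1 & 1 &\ldots & 1\\ -1 & 1 & 1 & \ldots & 1 & -1 &\ldots &-1\\\hline 1 & 1 & & & & & &\\ \vdots & \vdots & & C(A) & & &C(B)&\\ 1 & 1 & & & & & &\\\hline 1 & -1 & & & & & &\\ \vdots & \vdots & & C(\overline{B})^T & & &-C(\overline{A})^T&\\ 1 & -1 & & & & & & \end{array} \right)$$ is a quaternary Hadamard matrix of order $2\ell+2$. (ii) If $\ell$ is even, $\alpha=0$ and $\beta=1+i$, then $$\left(\begin{array}{cc|cccccc} -1 & i & 1 & \ldots & 1 & 1 &\ldots & 1\\ -i & 1 & 1 & \ldots & 1 & -1 &\ldots &-1\\\hline 1 & 1 & & & & & &\\ \vdots & \vdots & & C(A) & & &C(B)&\\ 1 & 1 & & & & & &\\\hline 1 & -1 & & & & & &\\ \vdots & \vdots & & C(\overline{B})^T & & &-C(\overline{A})^T&\\ 1 & -1 & & & & & & \end{array} \right)$$ is a quaternary Hadamard matrix of order $2\ell+2$. (In both matrices, the first two rows have $\ell$ entries $1$ in the columns above $C(A)$, and $\ell$ entries $1$, respectively $\ell$ entries $-1$, in the columns above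 $C(B)$; the four blocks are $\ell\times\ell$; the first two entries of each of the $\ell$ rows through $C(A)$ are $1,1$ and of each of the last $\ell$ rows are $1,-1$.)
   Context: Here $i=\sqrt{-1}$. A finite complex sequence $A=[a_0,\ldots,a_{\ell-1}]$ of length $\ell$ is continued periodically with period $\ell$ ($a_{j+\ell}=a_j$). Its periodic autocorrelation function is $PAF(A,s)=\sum_{j=0}^{\ell-1}a_j\overline{a_{j+s}}$, $s=0,1,\ldots,\ell-1$. Two sequences $A,B$ of length $\ell$ form a Legendre pair $(A,B)$ if $PAF(A,s)+PAF(B,s)=-2$ for $s=1,2,\ldots,\lfloor \ell/2\rfloor$ (equivalently, for $s=1,\ldots,\ell-1$, since $PAF(A,\ell-s)=\overline{PAF(A,s)}$). A Legendre pair is quaternary if $A,B\in\{-1,1,-i,i\}^\ell$. $\overline{A}$ denotes the entrywise complex conjugate of $A$. $C(A)$ denotes the $\ell\times\ell$ circulant matrix with first row $a_0,a_1,\ldots,a_{\ell-1}$, each further row being the cyclic right shift of the previous one: $$C(A)=\left(\begin{array}{ccccc} a_0 & a_1 & \ldots & a_{\ell-2} & a_{\ell-1}\\ a_{\ell-1} & a_0 & \ldots & a_{\ell-3} & a_{\ell-2}\\ \vdots & \vdots & & \vdots & \vdots\\ a_1 & a_2 & \ldots & a_{\ell-1}& a_0\end{array}\right).$$ A quaternary Hadamard matrix of order $n$ is an $n\times n$ matrix $H$ with entries in $\{-1,1,-i,i\}$ satisfying $H\overline{H}^T=nI_n$. *)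

(* Defs.v *)
From HB Require Import structures.
From mathcomp Require Import all_boot all_order all_algebra.

Set Implicit Arguments.
Unset Strict Implicit.
Unset Printing Implicit Defensive.

Import Order.TTheory GRing.Theory Num.Theory.
Local Open Scope ring_scope.

(* Complex numbers are taken in an arbitrary numClosedFieldType C: this covers
   R[i] for any real closed field R, in particular for the real numbers. *)

(* Periodic continuation; for l = 0 the value is 0. *)
Definition pext (C : numClosedFieldType) (l : nat) (A : l.-tuple C) (j : nat) : C :=
  nth 0 A (j %% l)%N.

Definition PAF (C : numClosedFieldType) (l : nat) (A : l.-tuple C) (s : nat) : C :=
  \sum_(j < l) pext A j * (pext A (j + s))^*.

Definition legendre_pair (C : numClosedFieldType) (l : nat) (A B : l.-tuple C) : Prop :=
  forall s : nat, (1 <= s <= l./2)%N -> PAF A s + PAF B s = -2.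

Definition quaternary (C : numClosedFieldType) (x : C) : bool :=
  x \in [:: -1; 1; -'i; 'i].

Definition quaternary_legendre_pair (C : numClosedFieldType) (l : nat)
    (A B : l.-tuple C) : Prop :=
  [/\ all (@quaternary C) A, all (@quaternary C) B & legendre_pair A B].

Definition conj_seq (C : numClosedFieldType) (l : nat) (A : l.-tuple C) : l.-tuple C :=
  map_tuple (fun x => x^*) A.

(* The (i, j) entry is a_(j - i), the index being shifted by l so that the
   subtraction on nat is not truncated. *)
Definition circulant (C : numClosedFieldType) (l : nat) (A : l.-tuple C) : 'M[C]_l :=
  \matrix_(i < l, j < l) pext A (j + (l - i)).

Definition quaternary_hadamard (C : numClosedFieldType) (n : nat) (H : 'M[C]_n) : Prop :=
  (forall i j, quaternary (H i j)) /\
  H *m (map_mx (fun x => x^*) H)^T = (n%:R)%:M.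

(* The order (1 + 1) + (l + l) is 2l + 2. *)
Definition bordered (C : numClosedFieldType) (l : nat) (x y z t : C)
    (A B : l.-tuple C) : 'M[C]_((1 + 1) + (l + l)) :=
  block_mx
    (block_mx x%:M y%:M
              z%:M t%:M : 'M[C]_(1 + 1, 1 + 1))
    (block_mx (const_mx 1) (const_mx 1)
              (const_mx 1) (const_mx (-1)) : 'M[C]_(1 + 1, l + l))
    (block_mx (const_mx 1) (const_mx 1)
              (const_mx 1) (const_mx (-1)) : 'M[C]_(l + l, 1 + 1))
    (block_mx (circulant A)               (circulant B)
              (circulant (conj_seq B))^T  (- (circulant (conj_seq A))^T)).

(* Main.v *)
Require Import Defs.
From HB Require Import structures.
From mathcomp Require Import all_boot all_order all_algebra.
From mathcomp Require Import ring zify.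
Set Implicit Arguments.
Unset Strict Implicit.
Unset Printing Implicit Defensive.
Import Order.TTheory GRing.Theory Num.Theory.
Local Open Scope ring_scope.

(** Write X^H for the conjugate transpose of X, J for an all-ones matrix, and
    split H into the border rows and columns and the four circulants.  Because
    C(conj A)^T = C(A)^H, the core of H is
      M = ( C(A)    C(B)   )
          ( C(B)^H  -C(A)^H ).
    Circulants commute ([circulantC]), and the adjoint of a circulant is again
    a circulant ([adjmx_circulant]), so circulants are normal.  Consequently
    the off-diagonal blocks of M M^H, such as C(A) C(B) - C(B) C(A), vanish,
    and both diagonal blocks equal C(A) C(A)^H + C(B) C(B)^H.  The entries of
    C(A) C(A)^H are the autocorrelations of A, so the Legendre condition says
    that this sum is (2l + 2) I - 2 J ([legendre_circulant]).  The two border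
    columns contribute 2 J to the diagonal blocks and (1 - 1) J = 0 to the
    off-diagonal ones, which corrects M M^H to (2l + 2) I.

    The rest concerns the two border rows.  All rows of a circulant have the
    same sum, so orthogonality of the border rows to the other rows amounts to
    four linear equations between the corner x, y, z, t and the sums alpha,
    beta; orthogonality of the border rows to each other is
    x z^* + y t^* = 0 ([bordered_hadamard]).  Both corners of the theorem solve
    these equations for their values of alpha and beta. *)

(** * Quaternary units *)

Section Quaternary.
Variable C : numClosedFieldType.
Implicit Type x : C.

Lemma quaternaryP x :
  reflect [\/ x = -1, x = 1, x = - 'i | x = 'i] (quaternary x).
Proof.
rewrite /quaternary !inE; apply: (iffP idP).
  by case/or4P=> /eqP ->; [apply: Or41 | apply: Or42 | apply: Or43 | apply: Or44].
by case=> ->; rewrite eqxx ?orbT.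
Qed.

Lemma quaternaryN x : quaternary x -> quaternary (- x).
Proof.
by case/quaternaryP=> ->; rewrite ?opprK; apply/quaternaryP;
  [apply: Or42 | apply: Or41 | apply: Or44 | apply: Or43].
Qed.

Lemma quaternary_conj x : quaternary x -> quaternary x^*.
Proof.
by case/quaternaryP=> ->; rewrite ?rmorphN ?rmorph1 /= ?conjCi ?opprK;
  apply/quaternaryP;
  [apply: Or41 | apply: Or42 | apply: Or44 | apply: Or43].
Qed.

Lemma quaternary_mul_conj x : quaternary x -> x * x^* = 1.
Proof.
by case/quaternaryP=> ->;
  rewrite ?rmorphN ?rmorph1 /= ?conjCi ?mulrNN ?mulrN ?mulNr ?mulr1 -?expr2 ?sqrCi
          ?opprK.
Qed.

Lemma quaternary1 : quaternary (1 : C).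
Proof. by apply/quaternaryP; apply: Or42. Qed.

End Quaternary.

(** * Conjugate transposes and constant matrices *)

Section Adjoint.
Variable C : numClosedFieldType.

Definition adjmx m n (M : 'M[C]_(m, n)) : 'M[C]_(n, m) :=
  (map_mx (fun x => x^*) M)^T.

Lemma adjmxE m n (M : 'M[C]_(m, n)) i j : adjmx M i j = (M j i)^*.
Proof. by rewrite !mxE. Qed.

Lemma adjmxK m n : cancel (@adjmx m n) (@adjmx n m).
Proof. by move=> M; apply/matrixP => i j; rewrite !adjmxE conjCK. Qed.

Lemma adjmxN m n (M : 'M[C]_(m, n)) : adjmx (- M) = - adjmx M.
Proof. by apply/matrixP => i j; rewrite !mxE rmorphN. Qed.

Lemma adjmxD m n (M N : 'M[C]_(m, n)) : adjmx (M + N) = adjmx M + adjmx N.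
Proof. by apply/matrixP => i j; rewrite !mxE rmorphD. Qed.

Lemma adjmxM m n p (M : 'M[C]_(m, n)) (N : 'M[C]_(n, p)) :
  adjmx (M *m N) = adjmx N *m adjmx M.
Proof. by rewrite /adjmx (map_mxM Num.conj) trmx_mul. Qed.

Lemma adjmx_const m n (c : C) : adjmx (const_mx c : 'M_(m, n)) = const_mx c^*.
Proof. by apply/matrixP => i j; rewrite !mxE. Qed.

Lemma adjmx_block m1 m2 n1 n2 (P : 'M[C]_(m1, n1)) (Q : 'M[C]_(m1, n2))
    (R : 'M[C]_(m2, n1)) (S : 'M[C]_(m2, n2)) :
  adjmx (block_mx P Q R S) =
  block_mx (adjmx P) (adjmx R) (adjmx Q) (adjmx S).
Proof. by rewrite /adjmx map_block_mx tr_block_mx. Qed.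

Lemma mul_const_mx m n p (a b : C) :
  (const_mx a : 'M_(m, n)) *m (const_mx b : 'M_(n, p)) =
  const_mx (n%:R * (a * b)).
Proof.
apply/matrixP => i j; rewrite !mxE.
under eq_bigr do rewrite !mxE.
by rewrite sumr_const card_ord mulr_natl.
Qed.

Lemma const_mxD m n (a b : C) :
  const_mx a + const_mx b = const_mx (a + b) :> 'M_(m, n).
Proof. by apply/matrixP => i j; rewrite !mxE. Qed.

Lemma const_mxN m n (a : C) : - const_mx a = const_mx (- a) :> 'M_(m, n).
Proof. by apply/matrixP => i j; rewrite !mxE. Qed.

Lemma const_mx11 (a : C) : a%:M = const_mx a :> 'M_1.
Proof. by apply/matrixP => i j; rewrite !mxE !ord1 eqxx. Qed.

End Adjoint.

(** * Circulants as functions on a cyclic group *)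

Section Circulant.
Variables (C : numClosedFieldType) (n : nat).
(* A successor, so that ['I_l] carries its additive group structure. *)
Local Notation l := n.+1.
Implicit Types A B : l.-tuple C.

(** In the statements below, indices subtract in the cyclic group on ['I_l]:
    sums over a row or a column can then be reindexed by the translations and
    reflections of that group, without any arithmetic modulo l. *)
Lemma circulantE A i j : circulant A i j = tnth A (j - i).
Proof. by rewrite !mxE (tnth_nth 0) /pext /= modnDmr. Qed.

Lemma PAFE A (d : 'I_l) :
  PAF A d = \sum_j tnth A j * (tnth A (j + d))^*.
Proof.
apply: eq_bigr => j _; rewrite !(tnth_nth 0) /pext /=.
by rewrite (modn_small (ltn_ord j)).
Qed.

(** Both sides are the circulant of the convolution of A and B, which is
    symmetric in A and B because the index group is abelian. *)
Lemma circulantC A B :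
  circulant A *m circulant B = circulant B *m circulant A.
Proof.
apply/matrixP => i j; rewrite !mxE.
(* Exchange the two factors by the reflection k -> i + j - k. *)
rewrite (reindex_inj (inj_comp (addrI i) (inj_comp (addrI j) oppr_inj))) /=.
apply: eq_bigr => k _; rewrite !circulantE mulrC.
have -> : j - (i + (j - k)) = k - i.
  by rewrite opprD opprB addrCA subrKC addrC.
by rewrite [i + _]addrC addrK.
Qed.

(** The involution j -> - j combined with conjugation realises the conjugate
    transpose on sequences. *)
Definition reverse_conj A : l.-tuple C := [tuple (tnth A (- i))^* | i < l].

Lemma adjmx_circulant A : adjmx (circulant A) = circulant (reverse_conj A).
Proof.
by apply/matrixP => i j; rewrite adjmxE !circulantE tnth_mktuple opprB.
Qed.

Lemma circulant_normal A :
  adjmx (circulant A) *m circulant A = circulant A *m adjmx (circulant A).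
Proof. by rewrite adjmx_circulant circulantC. Qed.

Lemma tr_circulant_conj A : (circulant (conj_seq A))^T = adjmx (circulant A).
Proof.
by apply/matrixP => i j; rewrite mxE adjmxE !circulantE tnth_map.
Qed.

Lemma adjmx_circulantC A B :
  adjmx (circulant A) *m adjmx (circulant B) =
  adjmx (circulant B) *m adjmx (circulant A).
Proof. by rewrite -!adjmxM circulantC. Qed.

Lemma circulant_mul_const A p (c : C) :
  circulant A *m (const_mx c : 'M_(l, p)) =
  const_mx ((\sum_j tnth A j) * c).
Proof.
apply/matrixP => i j; rewrite !mxE mulr_suml.
rewrite (reindex_inj (addIr i)) /=.
by apply: eq_bigr => k _; rewrite circulantE mxE addrK.
Qed.

Lemma const_mul_circulant A p (c : C) :
  (const_mx c : 'M_(p, l)) *m circulant A =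
  const_mx (c * \sum_j tnth A j).
Proof.
apply/matrixP => i j; rewrite !mxE mulr_sumr.
rewrite (reindex_inj (inj_comp (addrI j) oppr_inj)) /=.
by apply: eq_bigr => k _; rewrite circulantE mxE subKr.
Qed.

Lemma const_mul_adj_circulant A p (c : C) :
  (const_mx c : 'M_(p, l)) *m adjmx (circulant A) =
  const_mx (c * (\sum_j tnth A j)^*).
Proof.
apply: (can_inj (@adjmxK C _ _)).
rewrite adjmxM adjmxK !adjmx_const circulant_mul_const.
by rewrite rmorphM /= conjCK mulrC.
Qed.

Lemma circulant_mul_adj A i j :
  (circulant A *m adjmx (circulant A)) i j = PAF A (i - j)%R.
Proof.
rewrite PAFE mxE (reindex_inj (addIr i)) /=.
apply: eq_bigr => k _; rewrite adjmxE !circulantE addrK.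
by rewrite addrA.
Qed.

Lemma PAF_opp A (d : 'I_l) : PAF A (- d)%R = (PAF A d)^*.
Proof.
rewrite !PAFE rmorph_sum (reindex_inj (addIr d)) /=.
by apply: eq_bigr => j _; rewrite rmorphM /= conjCK addrK mulrC.
Qed.

(** The Legendre condition constrains only the shifts up to l/2; the Hermitian
    symmetry of the autocorrelation carries it to the other ones. *)
Lemma legendre_pair_neq0 A B (d : 'I_l) :
  legendre_pair A B -> d != 0 -> PAF A d + PAF B d = -2.
Proof.
move=> hAB; rewrite -val_eqE /= -lt0n => d_gt0.
have [d_le | d_gt] := leqP d l./2; first by apply: hAB; rewrite d_gt0.
rewrite -[d]opprK (PAF_opp A) (PAF_opp B) -rmorphD /=.
rewrite hAB ?rmorphN ?rmorph_nat //=.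
have d_lt := ltn_ord d.
rewrite modn_small; lia.
Qed.

Lemma quaternary_tnth A i : all (@quaternary C) A -> quaternary (tnth A i).
Proof. by move/all_tnthP; apply. Qed.

Lemma PAF0 A : all (@quaternary C) A -> PAF A (0%R : 'I_l) = l%:R.
Proof.
move=> qA; rewrite PAFE.
under eq_bigr do rewrite addr0 quaternary_mul_conj ?quaternary_tnth //.
by rewrite sumr_const card_ord.
Qed.

(** Off the diagonal the Legendre condition gives -2; on the diagonal the
    entries have modulus 1, so the sum is 2l = (2l + 2) - 2. *)
Lemma legendre_circulant A B : quaternary_legendre_pair A B ->
  circulant A *m adjmx (circulant A) + circulant B *m adjmx (circulant B) =
  ((1 + 1) + (l + l))%:R%:M - const_mx 2.
Proof.
case=> qA qB hAB; apply/matrixP => i j.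
rewrite mxE !circulant_mul_adj [RHS]mxE !mxE.
have [-> | ne_ij] := eqVneq i j.
  by rewrite subrr !PAF0 // mulr1n !natrD; ring.
by rewrite legendre_pair_neq0 ?subr_eq0 // mulr0n sub0r.
Qed.

(** * The bordered matrix *)

Definition quaternary_mx m p (M : 'M[C]_(m, p)) :=
  forall i j, quaternary (M i j).

Lemma quaternary_block m1 m2 p1 p2 (P : 'M[C]_(m1, p1)) (Q : 'M[C]_(m1, p2))
    (R : 'M[C]_(m2, p1)) (S : 'M[C]_(m2, p2)) :
  quaternary_mx P -> quaternary_mx Q -> quaternary_mx R -> quaternary_mx S ->
  quaternary_mx (block_mx P Q R S).
Proof.
by move=> qP qQ qR qS i j; do 2![rewrite mxE; case: split => ?].
Qed.

Lemma quaternary_const m p (c : C) :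
  quaternary c -> quaternary_mx (const_mx c : 'M_(m, p)).
Proof. by move=> qc i j; rewrite mxE. Qed.

Lemma quaternary_circulant A :
  all (@quaternary C) A -> quaternary_mx (circulant A).
Proof. by move=> qA i j; rewrite circulantE quaternary_tnth. Qed.

Lemma quaternary_adjmx m p (M : 'M[C]_(m, p)) :
  quaternary_mx M -> quaternary_mx (adjmx M).
Proof. by move=> qM i j; rewrite adjmxE quaternary_conj. Qed.

Lemma quaternary_mxN m p (M : 'M[C]_(m, p)) :
  quaternary_mx M -> quaternary_mx (- M).
Proof. by move=> qM i j; rewrite mxE quaternaryN. Qed.

(** The four linear equations express orthogonality of the border rows to the
    rows through C(A) and to the rows through C(B)^H, the last equation that of
    the border rows to each other. *)
Lemma bordered_hadamard A B (x y z t : C) :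
  let alpha := \sum_j tnth A j in
  let beta := \sum_j tnth B j in
  quaternary_legendre_pair A B ->
  [&& quaternary x, quaternary y, quaternary z & quaternary t] ->
  x + y + (alpha^* + beta^*) = 0 -> z + t + (alpha^* - beta^*) = 0 ->
  x - y + (beta - alpha) = 0 -> z - t + (beta + alpha) = 0 ->
  x * z^* + y * t^* = 0 ->
  quaternary_hadamard (bordered x y z t A B).
Proof.
move=> alpha beta hAB /and4P[qx qy qz qt] xyA ztA xyB ztB xz.
have [qA qB _] := hAB.
rewrite /quaternary_hadamard /bordered !tr_circulant_conj !const_mx11.
set E := block_mx (const_mx x) _ _ _.
set R := block_mx (const_mx 1) _ _ _.
set S := block_mx (const_mx 1) _ _ _.
set M := block_mx (circulant A) _ _ _.
split.
  have q1 := quaternary1 C; have qN1 := quaternaryN q1.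
  have [qCA qCB] := (quaternary_circulant qA, quaternary_circulant qB).
  apply: quaternary_block; apply: quaternary_block; try exact: quaternary_const.
  - exact: qCA.
  - exact: qCB.
  - exact: quaternary_adjmx.
  - exact/quaternary_mxN/quaternary_adjmx.
set N := ((1 + 1) + (l + l))%:R.
rewrite -/(adjmx _).
have adj_border m1 m2 n1 n2 :
    adjmx (block_mx (const_mx 1) (const_mx 1) (const_mx 1) (const_mx (-1))) =
    block_mx (const_mx 1) (const_mx 1) (const_mx 1) (const_mx (-1))
    :> 'M[C]_(m1 + m2, n1 + n2).
  by rewrite adjmx_block !adjmx_const rmorphN /= conjC1.
have ER : E *m adjmx S + R *m adjmx M = 0.
  rewrite adj_border adjmx_block !mulmx_block add_block_mx adjmxN !adjmxK.
  rewrite !mulmxN !const_mul_adj_circulant !const_mul_circulant -/alpha -/beta.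
  rewrite !mul_const_mx !const_mxN !const_mxD.
  rewrite -[0](block_mx0 _ 1 1 l l).
  congr block_mx; rewrite -[RHS]/(const_mx 0); congr const_mx.
  - by rewrite -xyA; ring.
  - by rewrite -xyB; ring.
  - by rewrite -ztA; ring.
  - by rewrite -ztB; ring.
have RE : S *m adjmx E + M *m adjmx R = 0.
  rewrite -[LHS]adjmxK adjmxD !adjmxM !adjmxK ER.
  by apply/matrixP=> i j; rewrite !mxE conjC0.
have EE : E *m adjmx E + R *m adjmx R = N%:M.
  rewrite adj_border adjmx_block !mulmx_block add_block_mx !adjmx_const.
  rewrite !mul_const_mx !const_mxD scalar_mx_block !const_mx11.
  have zx : z * x^* + t * y^* = 0.
    rewrite -[LHS]conjCK rmorphD !rmorphM /= !conjCK ![_^* * _]mulrC.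
    by rewrite xz conjC0.
  congr block_mx; rewrite -?[0 in RHS]/(const_mx 0); congr const_mx.
  - by rewrite !quaternary_mul_conj // /N !natrD; ring.
  - by rewrite -[RHS]xz; ring.
  - by rewrite -[RHS]zx; ring.
  - by rewrite !quaternary_mul_conj // /N !natrD; ring.
have SM : S *m adjmx S + M *m adjmx M = N%:M.
  have sumAB := legendre_circulant hAB.
  rewrite adj_border adjmx_block !mulmx_block add_block_mx !adjmxN !adjmxK.
  rewrite !mulmxN !mulNmx opprK !circulant_normal.
  rewrite [circulant B *m adjmx _ + circulant A *m _]addrC sumAB.
  rewrite [circulant B *m _]circulantC.
  rewrite [adjmx (circulant A) *m adjmx _]adjmx_circulantC.
  rewrite !subrr !addr0 !mul_const_mx !const_mxD scalar_mx_block.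
  have cJ c : c = 2 -> const_mx c + (N%:M - const_mx 2) = N%:M :> 'M_l.
    by move=> ->; rewrite addrC subrK.
  congr block_mx; rewrite ?cJ // -?[0 in RHS]/(const_mx 0).
  - by ring.
  - by congr const_mx; ring.
  - by congr const_mx; ring.
  - by ring.
rewrite adjmx_block mulmx_block EE ER RE SM.
by rewrite -scalar_mx_block.
Qed.

End Circulant.

Theorem theorem1 (C : numClosedFieldType) (l : nat) (hl : (1 <= l)%N)
    (A B : l.-tuple C) (hAB : quaternary_legendre_pair A B) :
  let alpha := \sum_(j < l) tnth A j in
  let beta := \sum_(j < l) tnth B j in
  (odd l -> alpha = 1 -> beta = 1 ->
     quaternary_hadamard (bordered (-1) (-1) (-1) 1 A B)) /\
  (~~ odd l -> alpha = 0 -> beta = 1 + 'i ->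
     quaternary_hadamard (bordered (-1) 'i (- 'i) 1 A B)).
Proof.
case: l hl A B hAB => // n _ A B hAB alpha beta.
have q1 := quaternary1 C; have qN1 := quaternaryN q1.
have qi : quaternary ('i : C) by apply/quaternaryP; apply: Or44.
split=> _ hA hB; apply: bordered_hadamard => //;
  rewrite -?/alpha -?/beta ?hA ?hB;
  rewrite ?q1 ?qN1 ?qi ?quaternaryN //;
  rewrite ?(rmorphN, rmorphD, rmorph0, conjC1, conjCi) /=;
  rewrite ?(conjC1, conjC0, conjCi);
  ring.
Qed.
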